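(* Let $\Gamma$ be a countable discrete group having an element of infinite order, and let $\Gamma\curvearrowright^a X$ be a distal topological $\Gamma$-system. Then $h^{\mathrm{tp}}_{\mathrm{nv}}(\Gamma\curvearrowright^a X)=0$, and $h_{\mathrm{nv}}(\Gamma\curvearrowright^a(X,\mu))=0$ for every invariant (Borel probability) measure $\mu$ for $\Gamma\curvearrowright^a X$.
   Context: A topological $\Gamma$-system $\Gamma \curvearrowright^a X$ consists of a compact metrizable space $X$ and a homomorphism $a:\Gamma\to \mathrm{Homeo}(X)$; write $\gamma^a$ for $a(\gamma)$. With $d$ a compatible metric on $X$, the system is distal if $\inf_{\gamma\in\Gamma}d(\gamma^ax_1,\gamma^ax_2)>0$ for every pair of distinct points $x_1,x_2\in X$. Naive topological entropy. For an open cover $\mathscr{U}$ of $X$, $N(\mathscr{U})$ is the minimal cardinality of a subcover. The join of finitely many open covers (or partitions) consists of all intersections of one element from each. Put $\gamma^a\mathscr{U}=\{\gamma^a U: U\in\mathscr{U}\}$ and, for finite $F\subseteq\Gamma$, $\mathscr{U}^F=\bigvee_{\gamma\in F}\gamma^a\mathscr{U}$. Define $h^{\mathrm{tp}}_{\mathrm{nv}}(\mathscr{U})=\inf_F \frac{1}{|F|}\log N(\mathscr{U}^F)$, the infimum over all nonempty finite $F\subseteq\Gamma$, and $h^{\mathrm{tp}}_{\mathrm{nv}}(\Gamma\curvearrowright^a X)=\sup\{h^{\mathrm{tp}}_{\mathrm{nv}}(\mathscr{U}) : \mathscr{U}\text{ a finite open cover of }X\}$. Naive measure entropy. For a finite measurable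 partition $\alpha=(A_1,\dots,A_n)$ of $(X,\mu)$, $H_\mu(\alpha)=-\sum_{i=1}^n\mu(A_i)\log\mu(A_i)$. Put $\gamma^a\alpha=\{\gamma^aA:A\in\alpha\}$ and $\alpha^F=\bigvee_{\gamma\in F}\gamma^a\alpha$ for finite $F\subseteq\Gamma$. Define $h_\mu(\alpha)=\inf_F\frac1{|F|}H_\mu(\alpha^F)$, the infimum over all nonempty finite $F\subseteq\Gamma$, and $h_{\mathrm{nv}}(\Gamma\curvearrowright^a(X,\mu))=\sup\{h_\mu(\alpha):\alpha\text{ a finite measurable partition of }X\}$. *)

(* Defs.v *)
From HB Require Import structures.
From mathcomp Require Import all_boot all_order all_algebra finmap.
From mathcomp Require Import all_classical all_reals all_analysis.

Set Implicit Arguments.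
Unset Strict Implicit.
Unset Printing Implicit Defensive.

Import Order.TTheory GRing.Theory Num.Theory.

Local Open Scope classical_set_scope.
Local Open Scope ring_scope.

(* The base point plays no role beyond excluding the empty space: the library's
   measurable types, hence the Borel space of X below, are pointed. *)
#[short(type="pmetricType")]
HB.structure Definition PointedMetric (R : numDomainType) :=
  {M of Metric R M & Pointed M}.

Notation borel X := (g_sigma_algebraType (@open X)).

Section systems.
Context {G : groupType} {X : topologicalType}.

Definition homeomorphism (f : X -> X) :=
  continuous f /\
  exists g : X -> X, [/\ continuous g, cancel f g & cancel g f].

(* a is a homomorphism from G to the group of homeomorphisms of X;
   a 1 = id follows, every a g being injective. *)
Definition is_action_by_homeo (a : G -> X -> X) :=
  (forall g, homeomorphism (a g)) /\
  {morph a : g h / (g * h)%g >-> g \o h}.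

End systems.

Definition has_infinite_order {G : groupType} (g : G) :=
  forall n : nat, (0 < n)%N -> (g ^+ n)%g <> 1%g.

Definition distal {R : realType} {G : groupType} {X : metricType R}
    (a : G -> X -> X) :=
  forall x y : X, x <> y -> 0 < inf [set mdist (a g x) (a g y) | g in [set: G]].

(* Covers and partitions are sets of subsets of T. *)
Section joins.
Context {T : Type}.

Definition join {I : choiceType} (F : {fset I}) (U : I -> set (set T)) :
    set (set T) :=
  [set \bigcap_(i in [set` F]) u i |
    u in [set u : I -> set T | forall i, i \in F -> U i (u i)]].

Definition join_translates {G : groupType} (a : G -> T -> T) (F : {fset G})
    (U : set (set T)) : set (set T) :=
  join F (fun g => [set a g @` A | A in U]).

Definition covers (U : set (set T)) := \bigcup_(A in U) A = [set: T].

(* On nat, the infimum of a nonempty set is its least element. *)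
Definition cover_number (U : set (set T)) : nat :=
  infimum 0%N [set #|` V|%fset |
    V in [set V : {fset set T} | [set` V] `<=` U /\ covers [set` V]]].

End joins.

Section topological_entropy.
Context (R : realType) {G : groupType} {X : topologicalType}.
Implicit Types (a : G -> X -> X) (U : set (set X)).

Definition finite_open_cover U :=
  [/\ finite_set U, U `<=` open & covers U].

Definition naive_top_entropy_cover a U : \bar R :=
  ereal_inf [set (ln (cover_number (join_translates a F U))%:R
                  / #|` F|%fset%:R)%:E |
    F in [set F : {fset G} | F != fset0]].

Definition naive_top_entropy a : \bar R :=
  ereal_sup [set naive_top_entropy_cover a U | U in finite_open_cover].

End topological_entropy.

Section measure_entropy.
Context {R : realType} {G : groupType} {d : measure_display}
  {T : measurableType d}.
Implicit Types (a : G -> T -> T) (mu : probability T R) (P : set (set T)).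

(* Members may be empty; as P is a set, the empty set occurs at most once and
   contributes 0 to the entropy. *)
Definition finite_measurable_partition P :=
  [/\ finite_set P, P `<=` measurable, trivIset P id & covers P].

Definition entropy mu P : R :=
  - \sum_(A \in P) (fine (mu A) * ln (fine (mu A))).

Definition naive_entropy_partition a mu P : \bar R :=
  ereal_inf [set (entropy mu (join_translates a F P) / #|` F|%fset%:R)%:E |
    F in [set F : {fset G} | F != fset0]].

Definition naive_entropy a mu : \bar R :=
  ereal_sup [set naive_entropy_partition a mu P |
    P in finite_measurable_partition].

Definition invariant_measure a mu :=
  forall g A, measurable A -> mu (a g @^-1` A) = mu A.

End measure_entropy.

(* Main.v *)
Require Import Defs.
From HB Require Import structures.
From mathcomp Require Import all_boot all_order all_algebra finmap.
From mathcomp Require Import all_classical all_reals all_analysis.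
From mathcomp Require Import zify lra.

(* Let h have infinite order and T = a(h^-1); taking F = {1, h, ..., h^(n-1)}
   in the infima, it suffices to bound entropies of the homeomorphism T, for
   which distality says that distinct points stay apart along forward orbits.

   Topological entropy: for disjoint closed sets A, B, suppose that the cover
   {A^c, B^c} has positive entropy. Splitting A into small closed pieces, one of
   them still gives positive entropy with B. Moreover some return time m > 0 is
   such that A' = A /\ T^-m A and B' = B /\ T^-m A still give positive
   entropy: otherwise, in a block of M times, recording only the last visit to A
   (M + 1 possibilities) and cheap codes for the returns would decide which of
   A, B is avoided at every time of the block. Now T^m A' and T^m B' lie in the
   small set A; iterating yields nested closed sets whose intersections contain
   x in A and y in B with inf_m d(T^m x, T^m y) = 0, against distality. Every
   open cover is refined by a finite join of covers {A^c, B^c}.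

   Measure entropy: shrink the members of a partition P to closed sets C_k
   losing little mass. The sets U_k, complement of the union of the C_l with
   l <> k, form an open cover. A point is coded by a member of a small subcover
   of the join of the T^-j U, together with the P-names at the rare times when
   the orbit is outside all the C_k; Gibbs' inequality bounds the entropy by the
   expected code length. *)

Set Implicit Arguments.
Unset Strict Implicit.
Unset Printing Implicit Defensive.

Import Order.TTheory GRing.Theory Num.Theory.

Local Open Scope classical_set_scope.
Local Open Scope ring_scope.

(** * Covers of zero entropy *)

Section zero_entropy.
Context (R : realType) {X : Type} (T : X -> X).

(* The words [v i] index a subcover of the join of the preimages of the cover
   [E] under the iterates of [T] of order less than [n]. *)
Definition zero_entropy {K : Type} (E : K -> set X) :=
  forall eps : R, 0 < eps -> \forall n \near \oo,
    exists (I : finType) (v : I -> nat -> K),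
      #|I|%:R <= expR (eps * n%:R) /\
      forall x, exists i, forall j, (j < n)%N -> E (v i j) (iter j T x).

Lemma zero_entropy_refine {K K' : Type} (E : K -> set X) (E' : K' -> set X) :
  (forall k', exists k, E' k' `<=` E k) -> zero_entropy E' -> zero_entropy E.
Proof.
move=> /choice[f fE] E'0 eps eps0; near=> n.
have [I [v [vn vx]]] : exists (I : finType) (v : I -> nat -> K'),
    #|I|%:R <= expR (eps * n%:R) /\
    forall x, exists i, forall j, (j < n)%N -> E' (v i j) (iter j T x).
  by near: n; exact: E'0.
exists I, (fun i j => f (v i j)); split=> // x.
by have [i iE'] := vx x; exists i => j /iE' /fE.
Unshelve. all: by end_near. Qed.

Lemma zero_entropy_setT {K : Type} (E : K -> set X) k :
  E k = [set: X] -> zero_entropy E.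
Proof.
move=> Ek eps eps0; near=> n; exists unit, (fun _ _ => k); split.
  by rewrite card_unit -expR0 ler_expR mulr_ge0// ltW.
by move=> x; exists tt => j _; rewrite Ek.
Unshelve. all: by end_near. Qed.

Lemma zero_entropyI {K K' : Type} (E : K -> set X) (E' : K' -> set X) :
  zero_entropy E -> zero_entropy E' ->
  zero_entropy (fun k : K * K' => E k.1 `&` E' k.2).
Proof.
move=> E0 E'0 eps eps0; have e20 : 0 < eps / 2 by rewrite divr_gt0.
near=> n.
have [I [v [vn vx]]] : exists (I : finType) (v : I -> nat -> K),
    #|I|%:R <= expR (eps / 2 * n%:R) /\
    forall x, exists i, forall j, (j < n)%N -> E (v i j) (iter j T x).
  by near: n; exact: E0.
have [I' [v' [v'n v'x]]] : exists (I : finType) (v : I -> nat -> K'),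
    #|I|%:R <= expR (eps / 2 * n%:R) /\
    forall x, exists i, forall j, (j < n)%N -> E' (v i j) (iter j T x).
  by near: n; exact: E'0.
exists (I * I')%type, (fun i j => (v i.1 j, v' i.2 j)); split.
  rewrite card_prod natrM (splitr eps) mulrDl expRD.
  by rewrite ler_pM.
move=> x; have [i iE] := vx x; have [i' iE'] := v'x x.
by exists (i, i') => j jn; split; [exact: iE|exact: iE'].
Unshelve. all: by end_near. Qed.

Lemma zero_entropy_bigI {K : Type} (k0 : K) (E : nat -> K -> set X) m :
  (forall i, (i < m)%N -> zero_entropy (E i)) ->
  zero_entropy (fun f : nat -> K =>
    [set x | forall i, (i < m)%N -> E i (f i) x]).
Proof.
elim: m => [_|m IHm E0].
  apply: (@zero_entropy_setT _ _ (fun=> k0)).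
  by apply/seteqP; split=> // x _ i.
have := zero_entropyI (IHm (fun i im => E0 i (leqW im))) (E0 m (ltnSn m)).
apply: zero_entropy_refine => -[f k].
exists (fun i => if (i < m)%N then f i else k) => x /= [fx kx] i.
rewrite ltnS leq_eqVlt => /orP[/eqP->|im]; first by rewrite ltnn.
by rewrite im; exact: fx.
Qed.

Definition avoid (A B : set X) (b : bool) : set X := ~` (if b then A else B).

Lemma zero_entropy_avoid_set0 (B : set X) : zero_entropy (avoid set0 B).
Proof. by apply: (@zero_entropy_setT _ _ true); rewrite /avoid setC0. Qed.

Lemma zero_entropy_avoidC (A B : set X) :
  zero_entropy (avoid A B) -> zero_entropy (avoid B A).
Proof. by apply: zero_entropy_refine => b; exists (~~ b); case: b. Qed.

Lemma zero_entropy_avoid_cover m (A B : set X) (D : nat -> set X) :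
  (forall x, exists2 i, (i < m)%N & D i x) ->
  (forall i, (i < m)%N -> zero_entropy (avoid (A `&` D i) B)) ->
  zero_entropy (avoid A B).
Proof.
move=> Dx D0; have := zero_entropy_bigI true D0.
apply: zero_entropy_refine => f.
have [[i im fi]|f1] := pselect (exists2 i, (i < m)%N & ~~ f i).
  by exists false => x /(_ i im); rewrite /avoid (negbTE fi).
exists true => x /= fx Ax; have [i im Dix] := Dx x.
have fi : f i by apply: contrapT => /negP fi; apply: f1; exists i.
by have := fx i im; rewrite /avoid fi; apply.
Qed.

(* [M + 1] counts the possible positions of the last visit to [A] in a block
   of length [M]. *)
Lemma exists_block_length (eps : R) : 0 < eps ->
  exists2 M, (0 < M)%N & M.+1%:R <= expR (eps * M%:R).
Proof.
move=> eps0.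
have [M M4] : exists M : nat, 4 / eps ^+ 2 <= M%:R :> R.
  exists (Num.truncn (4 / eps ^+ 2)).+1.
  by rewrite ltW// truncnS_gt.
have : 0 < 4 / eps ^+ 2 by rewrite divr_gt0// exprn_gt0.
move=> /lt_le_trans/(_ M4) M0.
exists M; first by rewrite -(ltr0n R).
have -> : eps * M%:R = 2%:R * (eps / 2 * M%:R) by lra.
rewrite expRM_natl.
have h : 1 + eps / 2 * M%:R <= expR (eps / 2 * M%:R) by exact: expR_ge1Dx.
apply: (@le_trans _ _ ((1 + eps / 2 * M%:R) ^+ 2)).
  move: M4; rewrite ler_pdivrMr ?exprn_gt0// => M4.
  rewrite -natr1; nra.
by rewrite lerXn2r// nnegrE ?expR_ge0// addr_ge0// mulr_ge0// ltW// divr_gt0.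
Qed.

Lemma last_visit (P : pred nat) M :
  exists t : 'I_M.+1, (forall o, (o < M)%N -> P o -> (o < t)%N) /\
    ((0 < t)%N -> P t.-1).
Proof.
pose Q (t : 'I_M.+1) := (t == ord0) || P t.-1.
have Q0 : Q ord0 by rewrite /Q eqxx.
have [t Qt tmax] := arg_maxnP (fun t : 'I_M.+1 => t : nat) Q0.
exists t; split=> [k kM Pk|t0].
  by have := tmax (Ordinal (kM : (k.+1 < M.+1)%N)); apply; rewrite /Q /= Pk.
by move: Qt; rewrite /Q -val_eqE /= eqn0Ngt t0.
Qed.

Lemma zero_entropy_return (A B : set X) : A `&` B = set0 ->
  (forall m, (0 < m)%N ->
    zero_entropy (avoid (A `&` iter m T @^-1` A) (B `&` iter m T @^-1` A))) ->
  zero_entropy (avoid A B).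
Proof.
move=> AB0 AB eps eps0; have e30 : 0 < eps / 3 by rewrite divr_gt0.
have [M M0 Me] := exists_block_length e30.
have /(_ _ e30) := zero_entropy_bigI (m := M) true (fun i _ => AB i.+1 isT).
move=> E0; near=> n.
have Mn : (M <= n)%N by near: n; exact: nbhs_infty_ge.
have [I [v [vn vx]]] : exists (I : finType) (v : I -> nat -> nat -> bool),
    #|I|%:R <= expR (eps / 3 * n%:R) /\
    forall x, exists i, forall j, (j < n)%N ->
      forall m, (m < M)%N -> avoid (A `&` iter m.+1 T @^-1` A)
        (B `&` iter m.+1 T @^-1` A) (v i j m) (iter j T x).
  by near: n; exact: E0.
pose L := (n %/ M).+1.
(* In a block whose last visit to [A] is at offset [t - 1] (no visit if
   [t = 0]), the earlier times are decided by the return to [A] at that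
   visit, the visit itself avoids [B], and the later times avoid [A]. *)
pose w (u : I * {ffun 'I_L -> 'I_M.+1}) (j : nat) : bool :=
  let o := (j %% M)%N in let t := (u.2 (inord (j %/ M)) : nat) in
  if (o.+1 < t)%N then v u.1 j (t.-1 - o).-1 else (o.+1 != t)%N.
exists (I * {ffun 'I_L -> 'I_M.+1})%type, w; split.
  rewrite card_prod card_ffun !card_ord natrM natrX.
  have -> : eps * n%:R = eps / 3 * n%:R + (eps / 3 * n%:R + eps / 3 * n%:R).
    by lra.
  rewrite expRD ler_pM// /L exprSr expRD.
  apply: ler_pM => //.
  - apply: (@le_trans _ _ (expR (eps / 3 * M%:R) ^+ (n %/ M))).
      by rewrite lerXn2r// nnegrE ?expR_ge0.
    rewrite -expRM_natr ler_expR -mulrA -natrM ler_pM2l//.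
    by rewrite ler_nat mulnC leq_trunc_div.
  - by rewrite (le_trans Me)// ler_expR ler_pM2l// ler_nat.
move=> x; have [i ix] := vx x.
have /choice[t tP] := fun b : 'I_L =>
  last_visit (fun o => `[< A (iter (b * M + o) T x) >]) M.
exists (i, [ffun b => t b]) => j jn.
have jL : (j %/ M < L)%N by rewrite /L ltnS leq_div2r// ltnW.
rewrite /w /= ffunE; set b := inord _.
have bE : b = (j %/ M)%N :> nat by rewrite /b inordK.
have jE : j = (b * M + j %% M)%N by rewrite bE -divn_eq.
have oM : (j %% M < M)%N by rewrite ltn_mod.
have [tlast tvisit] := tP b.
case: ifPn => [lt_ot|].

  have tM : (t b <= M)%N by rewrite -ltnS.
  have t1 : (0 < t b)%N by apply: leq_trans lt_ot.
  have mM : ((t b).-1 - j %% M).-1.+1 = ((t b).-1 - j %% M)%N by lia.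
  have /(_ _)/= := ix j jn ((t b).-1 - j %% M).-1.
  rewrite {1}(_ : ((t b).-1 - j %% M).-1 < M = true)%N; last by lia.
  move=> /(_ isT); rewrite /avoid mM.
  have At : A (iter ((t b).-1 - j %% M) T (iter j T x)).
    rewrite -iterD.
    have -> : ((t b).-1 - j %% M + j = b * M + (t b).-1)%N by lia.
    exact/asboolP/tvisit.
  by case: (v i j _) => /= h ABj; apply: h.
rewrite -leqNgt => tle; rewrite /avoid.
case: eqP => [eq_ot|/eqP ne_ot] /= Bj.
  have t1 : (0 < t b)%N by rewrite -eq_ot.
  have /asboolP := tvisit t1.
  rewrite -eq_ot /= -jE => Aj.
  suff : (A `&` B) (iter j T x) by rewrite AB0.
  by [].
have : (j %% M < t b)%N by apply: tlast => //; apply/asboolP; rewrite -jE.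
lia.
Unshelve. all: by end_near. Qed.

End zero_entropy.

(** * Distal maps of compact metric spaces *)

Lemma continuous_iter {X : topologicalType} (T : X -> X) m :
  continuous T -> continuous (iter m T).
Proof.
move=> cT; elim: m => [|m IHm] x; first exact: cvg_id.
exact: (continuous_comp (IHm x) (cT _)).
Qed.

Section compact_sets.
Context {X : ptopologicalType}.

Lemma compact_nested (F : nat -> set X) : compact [set: X] ->
  (forall k, closed (F k)) -> (forall k, F k.+1 `<=` F k) ->
  (forall k, F k !=set0) -> exists x, forall k, F k x.
Proof.
move=> cX Fcl Fsub F0; apply: contrapT => nF.
have Fmono m n : (m <= n)%N -> F n `<=` F m.
  move/subnK => <-; elim: (n - m)%N => [//|k IHk].
  by rewrite addSn; exact: subset_trans (Fsub _) IHk.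
move: cX; rewrite compact_cover => /(_ _ [set: nat] (fun k => ~` F k)).
case.
- by move=> k _; rewrite openC.
- move=> x _; apply: contrapT => nx; apply: nF; exists x => k.
  by apply: contrapT => Fkx; apply: nx; exists k.
move=> D' _ D'cov; have [x Fx] := F0 (\max_(k <- D') k)%N.
have [k /= kD' Fkx] := D'cov x I.
by apply: Fkx; apply: Fmono Fx; exact: leq_bigmax_seq.
Qed.

Lemma compact_nat_cover (P : set X -> Prop) : compact [set: X] ->
  (forall x : X, exists D, P D /\ nbhs x D) ->
  exists m (D : nat -> set X), (forall i, P (D i)) /\
    forall x, exists2 i, (i < m)%N & D i x.
Proof.
move=> cX /choice[D PD]; move: cX; rewrite compact_cover.
move=> /(_ _ [set: X] (fun x => interior (D x))) [].
- by move=> x _; exact: open_interior.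
- by move=> x _; exists x => //; have [] := PD x.
move=> D' _ D'cov.
exists (size (enum_fset D')), (fun i => D (nth point (enum_fset D') i)).
split=> [i|x]; first by have [] := PD (nth point (enum_fset D') i).
have [y yD' Dyx] := D'cov x I.
exists (index y (enum_fset D')); first by rewrite index_mem.
by rewrite nth_index//; exact: interior_subset.
Qed.

End compact_sets.

Section closed_balls.
Context {R : realType} {X : metricType R}.

Definition cball (x : X) (e : R) : set X := [set y | mdist x y <= e].

Lemma closed_cball x e : closed (cball x e).
Proof.
rewrite -[cball _ _]setCK closedC openE => y /negP; rewrite -ltNge => exy.
apply/nbhs_ballP; exists (mdist x y - e); first by rewrite /= subr_gt0.
move=> z; rewrite ballEmdist /= ltrBrDl -ltrBrDr => yz; apply/negP.
rewrite -ltNge (lt_le_trans yz)// lerBlDr.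
by rewrite (metric_sym y); exact: metric_triangle.
Qed.

Lemma open_mball (x : X) (e : R) : open (ball x e).
Proof.
rewrite openE => y; rewrite ballEmdist /= => xy; apply/nbhs_ballP.
exists (e - mdist x y); first by rewrite /= subr_gt0.
move=> z; rewrite ballEmdist /= ltrBrDl => yz.
exact: le_lt_trans (metric_triangle x y z) yz.
Qed.

Lemma nbhs_cball x e : 0 < e -> nbhs x (cball x e).
Proof.
move=> e0; apply/nbhs_ballP; exists e => //= y.
by rewrite ballEmdist /= => /ltW.
Qed.

Lemma nbhs_sub_cball x (U : set X) : nbhs x U ->
  exists2 e, 0 < e & cball x e `<=` U.
Proof.
move=> /nbhs_ballP[e /= e0 eU]; exists (e / 2); first by rewrite divr_gt0.
move=> y /= xy; apply: eU; rewrite ballEmdist /= (le_lt_trans xy)//.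
by rewrite ltr_pdivrMr// ltr_pMr// ltr1n.
Qed.

End closed_balls.

Section distal_zero_entropy.
Context (R : realType) {X : pmetricType R} (T : X -> X).
Hypothesis X_compact : compact [set: X].

Lemma closed_preimage_iter (A : set X) m :
  continuous T -> closed A -> closed (iter m T @^-1` A).
Proof.
by move=> cT cA; apply: closed_comp => // x _; exact: continuous_iter.
Qed.

Let pos (AB : set X * set X) :=
  [/\ closed AB.1, closed AB.2, AB.1 `&` AB.2 = set0 &
      ~ zero_entropy R T (avoid AB.1 AB.2)].

(* Shrinking [A] first makes the return of both new sets to [A] a proximity. *)
Lemma positive_entropy_shrink (A B : set X) (e : R) :
  continuous T -> 0 < e -> pos (A, B) ->
  exists A' B' m, [/\ pos (A', B'), A' `<=` A, B' `<=` B &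
    forall x y, A' x -> B' y -> mdist (iter m T x) (iter m T y) < e].
Proof.
move=> cT e0 [/= cA cB AB0 ABpos].
have [m [D [cD Dcov]]] : exists m (D : nat -> set X),
    (forall i, closed (D i) /\
      forall x y, D i x -> D i y -> mdist x y < e) /\
    forall x, exists2 i, (i < m)%N & D i x.
  apply: (compact_nat_cover (P := fun D => closed D /\
      forall x y, D x -> D y -> mdist x y < e)) => // x.
  exists (cball x (e / 3)); split; last by apply: nbhs_cball; rewrite divr_gt0.
  split; first exact: closed_cball.
  rewrite /cball => y z /= xy xz; apply: le_lt_trans (metric_triangle y x z) _.
  by rewrite (metric_sym y); lra.
have [i ABi] : exists i, ~ zero_entropy R T (avoid (A `&` D i) B).
  apply: contrapT => ABi; apply: ABpos.
  apply: zero_entropy_avoid_cover Dcov _ => i _.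
  by apply: contrapT => ?; apply: ABi; exists i.
have [cDi Di] := cD i.
set A1 := A `&` D i in ABi.
have cA1 : closed A1 by exact: closedI.
have A1B0 : A1 `&` B = set0 by rewrite /A1 setIAC AB0 set0I.
have [r ABr] : exists r,
    ~ zero_entropy R T (avoid (A1 `&` iter r T @^-1` A1)
                              (B `&` iter r T @^-1` A1)).
  apply: contrapT => ABr; apply: ABi.
  apply: zero_entropy_return => // r _.
  by apply: contrapT => ?; apply: ABr; exists r.
have cA1r : closed (A1 `&` iter r T @^-1` A1).
  by apply: closedI => //; exact: closed_preimage_iter.
have cBr : closed (B `&` iter r T @^-1` A1).
  by apply: closedI => //; exact: closed_preimage_iter.
exists (A1 `&` iter r T @^-1` A1), (B `&` iter r T @^-1` A1), r; split.
- split; [exact: cA1r|exact: cBr| |exact: ABr].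
  by rewrite [LHS]setIACA A1B0 set0I.
- by move=> x [[]].
- by move=> x [].
- by move=> x y [_ [_ ?]] [_ [_ ?]]; exact: Di.
Qed.

Lemma distal_zero_entropy_avoid (A B : set X) : continuous T ->
  (forall x y, x <> y ->
    exists2 e, 0 < e & forall m, e <= mdist (iter m T x) (iter m T y)) ->
  closed A -> closed B -> A `&` B = set0 -> zero_entropy R T (avoid A B).
Proof.
move=> cT dT cA cB AB0; apply: contrapT => ABpos.
pose step (s t : nat * {AB | pos AB}) :=
  t.1 = s.1.+1 /\ exists m,
  [/\ (sval t.2).1 `<=` (sval s.2).1, (sval t.2).2 `<=` (sval s.2).2 &
    forall x y, (sval t.2).1 x -> (sval t.2).2 y ->
      mdist (iter m T x) (iter m T y) < s.1.+1%:R^-1].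
have [s0 [s00 sS]] : exists s : nat -> nat * {AB | pos AB},
    (s 0%N).1 = 0%N /\ forall k, step (s k) (s k.+1).
  have AB : pos (A, B) by [].
  have stepP s : {t | step s t}.
    apply/cid; case: s => k [[A1 B1] AB1].
    have k0 : 0 < k.+1%:R^-1 :> R by rewrite invr_gt0.
    have [A2 [B2 [m [AB2 A2A1 B2B1 md]]]] := positive_entropy_shrink cT k0 AB1.
    by exists (k.+1, exist _ (A2, B2) AB2); split=> //; exists m.
  have [s [s0 ss]] := dependent_choice stepP (0%N, exist _ (A, B) AB).
  by exists s; rewrite s0.
have s1 k : (s0 k).1 = k by elim: k => // k; have [-> _] := sS k => ->.
pose F k := (sval (s0 k).2).1; pose G k := (sval (s0 k).2).2.
have FG k : pos (F k, G k) by rewrite /F /G -surjective_pairing; exact: (svalP (s0 k).2).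
have [x Fx] : exists x, forall k, F k x.
  apply: compact_nested => // k; first by have [] := FG k.
    by have [_ [m []]] := sS k.
  have [_ _ _ p] := FG k; apply/set0P/eqP => /= Fk0; apply: p.
  by rewrite /= Fk0; exact: zero_entropy_avoid_set0.
have [y Gy] : exists y, forall k, G k y.
  apply: compact_nested => // k; first by have [] := FG k.
    by have [_ [m []]] := sS k.
  have [_ _ _ p] := FG k; apply/set0P/eqP => /= Gk0; apply: p.
  by rewrite /= Gk0; exact/zero_entropy_avoidC/zero_entropy_avoid_set0.
have xy : x <> y.
  have [_ _ FG0 _] := FG 0%N => xy; suff : (F 0%N `&` G 0%N) x by rewrite FG0.
  by split; [exact: Fx|rewrite xy; exact: Gy].
have [e e0 exy] := dT _ _ xy.
have [k ke] : exists k, k.+1%:R^-1 < e.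
  exists (Num.truncn e^-1).
  by rewrite invf_plt ?posrE// truncnS_gt.
have [_ [m [_ _ md]]] := sS k.
have := md _ _ (Fx k.+1) (Gy k.+1); rewrite s1 => mxy.
by have := lt_trans (le_lt_trans (exy m) mxy) ke; rewrite ltxx.
Qed.

Lemma distal_zero_entropy_cover (K : Type) (E : K -> set X) : continuous T ->
  (forall x y, x <> y ->
    exists2 e, 0 < e & forall m, e <= mdist (iter m T x) (iter m T y)) ->
  (forall k, open (E k)) -> (forall x, exists k, E k x) ->
  zero_entropy R T E.
Proof.
move=> cT dT oE Ecov.
have [m [D [PD Dcov]]] : exists m (D : nat -> set X),
    (forall i, closed (D i) /\ exists k, D i `<=` E k) /\
    forall x, exists2 i, (i < m)%N & D i x.
  apply: (compact_nat_cover (P := fun D => closed D /\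
    exists k, D `<=` E k)) => // x.
  have [k Ekx] := Ecov x.
  have [e e0 eE] := nbhs_sub_cball (open_nbhs_nbhs (conj (oE k) Ekx)).
  exists (cball x e); split; last exact: nbhs_cball.
  by split; [exact: closed_cball|exists k].
have /choice[k kE] := fun i => (PD i).2.
have D0 i : zero_entropy R T (avoid (~` E (k i)) (D i)).
  apply: distal_zero_entropy_avoid => //; first by rewrite closedC.
    by have [] := PD i.
  by rewrite setIC; apply/disjoints_subset; rewrite setCK.
apply: zero_entropy_refine (zero_entropy_bigI (m := m) true (fun i _ => D0 i)).
move=> f; have [[i im fi]|f1] := pselect (exists2 i, (i < m)%N & f i).
  by exists (k i) => x /(_ i im); rewrite /avoid fi setCK.
have [k0 _] := Ecov point; exists k0 => x /= fx.
have [i im Dix] := Dcov x; have := fx i im; rewrite /avoid.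
by case: ifP => // fi; exfalso; apply: f1; exists i.
Qed.

End distal_zero_entropy.

(** * Topological entropy along a cyclic subgroup *)

Section cyclic_subgroup.
Context {G : groupType} {T : Type} (a : G -> T -> T) (h : G).
Hypothesis a_morph : {morph a : g k / (g * k)%g >-> g \o k}.
Hypothesis a1 : a 1%g = id.
Hypothesis h_order : has_infinite_order h.

Lemma action_expg g n x : a (g ^+ n)%g x = iter n (a g) x.
Proof.
elim: n => [|n IHn]; first by rewrite expg0 a1.
by rewrite expgS a_morph /= IHn.
Qed.

Lemma action_inv_image g (A : set T) : a g @` A = a g^-1%g @^-1` A.
Proof.
have aK k x : a k (a k^-1%g x) = x.
  by rewrite -[LHS]/((a k \o a k^-1%g) x) -a_morph mulgV a1.
apply/seteqP; split=> x /=.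
  by move=> [y Ay <-]; have := aK g^-1%g y; rewrite invgK => ->.
by move=> Ax; exists (a g^-1%g x).
Qed.

Definition powers n : seq G := mkseq (fun j => (h ^+ j)%g) n.

Lemma uniq_powers n : uniq (powers n).
Proof.
apply/mkseq_uniqP => i j _ _; wlog ij : i j / (i <= j)%N.
  by move=> H; case/orP: (leq_total i j) => ? ?; [|symmetry]; exact: H.
rewrite -{1}(subnK ij) expgnDr => /(congr1 (fun x => x * (h ^+ i)^-1)%g).
rewrite mulgV mulgK => hij.
apply/eqP; rewrite eqn_leq ij /= -subn_eq0 eqn0Ngt; apply/negP.
by move=> /h_order; exact.
Qed.

Definition fset_powers n : {fset G} := [fset g in powers n]%fset.

Lemma card_fset_powers n : #|` fset_powers n|%fset = n.
Proof. by rewrite card_fseq undup_id ?uniq_powers// size_mkseq. Qed.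

Lemma join_translates_powersP n (P : set (set T)) (B : set T) :
  join_translates a (fset_powers n) P B <->
  exists2 v : nat -> set T, (forall j, (j < n)%N -> P (v j)) &
    B = [set x | forall j, (j < n)%N -> v j (iter j (a h^-1%g) x)].
Proof.
have image_power j A : a (h ^+ j)%g @` A = iter j (a h^-1%g) @^-1` A.
  by rewrite action_inv_image -expVgn; apply/funext => x /=; rewrite action_expg.
have powersP g : g \in fset_powers n -> exists2 j, (j < n)%N & g = (h ^+ j)%g.
  by rewrite in_fset => /mapP[j]; rewrite mem_iota add0n => ? ->; exists j.
have powers_in j : (j < n)%N -> (h ^+ j)%g \in fset_powers n.
  by move=> jn; rewrite in_fset map_f// mem_iota.
split=> [[u uP <-]|[v vP ->]].
  have /choice[v vP] j : exists A, (j < n)%N ->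
      P A /\ u (h ^+ j)%g = iter j (a h^-1%g) @^-1` A.
    case: (ltnP j n) => [jn|_]; last by exists set0.
    have [A PA uA] := uP _ (powers_in _ jn).
    by exists A => _; rewrite -image_power uA.
  exists v => [j /vP[]//|]; apply/seteqP; split=> [x xu j jn|x xv g /powersP].
    by have := xu _ (powers_in _ jn); rewrite (vP j jn).2.
  by move=> [j jn ->]; rewrite (vP j jn).2; exact: xv.
pose u g := a g @` v (index g (powers n)).
have uE j : (j < n)%N -> u (h ^+ j)%g = iter j (a h^-1%g) @^-1` v j.
  move=> jn; rewrite /u image_power.
  by rewrite -{1}(nth_mkseq 1%g (fun j => h ^+ j)%g jn) index_uniq ?size_mkseq// uniq_powers.
exists u => [g /powersP[j jn ->]|].
  by rewrite uE// -image_power; exists (v j) => //; exact: vP.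
apply/seteqP; split=> [x xu j jn|x xv g /powersP[j jn ->]].
  by have := xu _ (powers_in _ jn); rewrite uE.
by rewrite uE//; exact: xv.
Qed.

End cyclic_subgroup.

Lemma cover_number_le {T : Type} (U : set (set T)) (V : {fset set T}) :
  [set` V] `<=` U -> covers [set` V] -> (cover_number U <= #|` V|%fset)%N.
Proof.
move=> VU covV; apply: (@le_infimum_Nmem _ nat); last by exists V.
set A := (X in infimums X).
have A0 : exists n, `[< A n >] by exists #|` V|%fset; apply/asboolP; exists V.
have [m /asboolP Am mmin] := ex_minnP A0.
exists m; split=> [n An|n]; last exact.
by rewrite leEnat mmin//; exact/asboolP.
Qed.

Lemma ln_natr_le {R : realType} (n : nat) (x : R) :
  0 <= x -> n%:R <= expR x -> ln n%:R <= x.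
Proof.
case: n => [x0 _|n _ nx]; first by rewrite ln0.
by rewrite -(expRK x) ler_ln// posrE ?expR_gt0.
Qed.

Section naive_topological_entropy.
Context (R : realType) {G : groupType} {X : topologicalType}.
Variables (a : G -> X -> X) (h : G).
Hypothesis a_morph : {morph a : g k / (g * k)%g >-> g \o k}.
Hypothesis a1 : a 1%g = id.
Hypothesis h_order : has_infinite_order h.

Lemma naive_top_entropy_ge0 : (0 <= naive_top_entropy R a)%E.
Proof.
have : finite_open_cover [set [set: X]].
  split; first exact: finite_set1.
    by move=> _ ->; exact: openT.
  by rewrite /covers bigcup_set1.
move=> XU; apply: le_trans (ereal_sup_ubound _); last by exists [set [set: X]].
apply: le_ereal_inf_tmp => _ [F _ <-]; rewrite lee_fin divr_ge0//.
case: cover_number => [|n]; first by rewrite ln0.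
by rewrite ln_ge0// ler1n.
Qed.

Lemma naive_top_entropy_cover_le0 (U : set (set X)) :
  zero_entropy R (a h^-1%g) (fun A : set X => [set x | U A /\ A x]) ->
  (naive_top_entropy_cover R a U <= 0)%E.
Proof.
move=> U0; apply/lee_addgt0Pr => e e0; rewrite add0e.
have [n [n0 [I [v [vn vx]]]]] : exists n : nat, (0 < n)%N /\
    exists (I : finType) (v : I -> nat -> set X), #|I|%:R <= expR (e * n%:R) /\
    forall x, exists i, forall j, (j < n)%N ->
      U (v i j) /\ v i j (iter j (a h^-1%g) x).
  near \oo => n; exists n; split; first by near: n; exact: nbhs_infty_gt.
  by near: n; exact: U0.
apply: le_trans (ereal_inf_lbound _) _.
  exists (fset_powers h n) => //=.
  by rewrite -cardfs_gt0 card_fset_powers.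
rewrite lee_fin card_fset_powers// ler_pdivrMr ?ltr0n//.
apply: ln_natr_le; first by rewrite mulr_ge0// ltW.
apply: le_trans vn; rewrite ler_nat.
pose J i := `[< forall j, (j < n)%N -> U (v i j) >].
pose B i := [set x | forall j, (j < n)%N -> v i j (iter j (a h^-1%g) x)].
pose V : {fset set X} := [fset B i | i in [pred i : I | J i]]%fset.
apply: (@leq_trans #|` V|%fset).
  apply: cover_number_le.
    move=> A /= /imfsetP[i /=]; rewrite inE => Ji ->.
    apply/(join_translates_powersP a_morph a1 h_order); exists (v i) => //.
  apply/seteqP; split=> // x _; have [i iv] := vx x.
  exists (B i); last by move=> j /iv[].
  by apply/imfsetP; exists i => //=; rewrite inE => j /iv[].
by rewrite (leq_trans (leq_imfset_card _ _ _))// -cardE max_card.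
Unshelve. all: by end_near. Qed.

End naive_topological_entropy.

(** * Regularity of finite Borel measures *)

Lemma nonincreasing_measure_small {d} {T : measurableType d} {R : realType}
    (mu : {finite_measure set T -> \bar R}) (F : nat -> set T) (e : R) :
  0 < e -> (forall n, measurable (F n)) ->
  (forall n m, (n <= m)%N -> F m `<=` F n) -> \bigcap_n F n = set0 ->
  exists n, (mu (F n) <= e%:E)%E.
Proof.
move=> e0 mF Fdec F0; apply: contrapT => nF.
have Flarge n : (e%:E <= mu (F n))%E.
  by rewrite leNgt; apply/negP => /ltW Fn; apply: nF; exists n.
have Fcvg : mu \o F @ \oo --> mu (\bigcap_n F n).
  apply: nonincreasing_cvg_mu => //.
  - by rewrite -ge0_fin_numE// fin_num_measure.
  - by rewrite F0.
  - by move=> n m nm; apply/subsetPset; exact: Fdec.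
have : (e%:E <= limn (mu \o F))%E.
  by apply: lime_ge; [apply/cvg_ex; eexists; exact: Fcvg|exact: nearW].
by rewrite (cvg_lim _ Fcvg)// F0 measure0 lee_fin leNgt e0.
Qed.

Section regularity.
Context {R : realType} {X : pmetricType R}.
Variable mu : {finite_measure set (borel X) -> \bar R}.

Let open_measurable_borel (U : set X) :
  open U -> measurable (U : set (borel X)).
Proof. by move=> oU; exact: sub_gen_smallest. Qed.

Let closed_measurable_borel (C : set X) :
  closed C -> measurable (C : set (borel X)).
Proof.
move=> cC; rewrite -[C]setCK.
by apply: measurableC; apply: open_measurable_borel; rewrite openC.
Qed.

Definition regular (A : set X) := forall e : R, 0 < e ->
  exists C U : set X, [/\ closed C, open U, C `<=` A, A `<=` U &
    (mu (U `\` C : set (borel X)) <= e%:E)%E].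

Lemma open_regular (U : set X) : open U -> regular U.
Proof.
move=> oO e e0.
pose C n := [set x | forall y, mdist x y < n.+1%:R^-1 -> U y].
have cC n : closed (C n).
  have -> : C n = ~` \bigcup_(y in ~` U) ball y n.+1%:R^-1.
    apply/seteqP; split=> [x Cx [y Uy]|x nx y xy].
      by rewrite ballEmdist /= metric_sym => /Cx.
    apply: contrapT => Uy; apply: nx; exists y => //.
    by rewrite ballEmdist /= metric_sym.
  rewrite closedC; apply: bigcup_open => y _; exact: open_mball.
have CO n : C n `<=` U by move=> x; apply; rewrite mdistxx invr_gt0.
have [|n|n m nm x [Ux nCx]| |n Cn] :=
    @nonincreasing_measure_small _ _ _ mu (fun n => U `\` C n) e => //.
- by apply: measurableD; [exact: open_measurable_borel|
    exact: closed_measurable_borel].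
- split=> // Cx; apply: nCx => y xy; apply: Cx; apply: lt_le_trans xy _.
  by rewrite lef_pV2 ?posrE// ler_nat.
- rewrite -subset0 => x nOC; have [Ux _] := nOC 0%N I.
  have [d d0 dO] : exists2 d, 0 < d & ball x d `<=` U.
    by have /nbhs_ballP[d] := open_nbhs_nbhs (conj oO Ux); exists d.
  have [_] := nOC (Num.truncn d^-1) I; apply=> y xy.
  apply: dO; rewrite ballEmdist /=; apply: lt_trans xy _.
  by rewrite invf_plt ?posrE// truncnS_gt.
exists (C n), U; split=> //; exact: CO.
Qed.

Lemma regular_sigma_algebra : sigma_algebra [set: X] regular.
Proof.
split=> [e e0|A Areg e e0|A Areg e e0].
- exists set0, set0; rewrite set0D measure0; split=> //; [exact: closed0|
    exact: open0|by rewrite lee_fin ltW].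
- have [C [U [cC oO CA AO OC]]] := Areg _ e0.
  exists (~` U), (~` C); split.
  + by rewrite closedC.
  + by rewrite openC.
  + by move=> x Ux; split=> // /AO.
  + by move=> x [_ Ax] /CA.
  + by rewrite setDE setCK setIC -setDE.
have e20 : 0 < e / 2 by rewrite divr_gt0.
have ek0 k : 0 < e / 2 / (2 ^ k.+1)%:R by rewrite divr_gt0// ltr0n expn_gt0.
have /choice[C /choice[U CO]] := fun k => Areg k _ (ek0 k).
pose D n := \bigcup_(k in `I_n) C k.
have cD n : closed (D n).
  by apply: closed_bigcup => // k _; have [] := CO k.
have oO : open (\bigcup_k U k) by apply: bigcup_open => k _; have [] := CO k.
have mO k : measurable (U k : set (borel X)).
  by apply: open_measurable_borel; have [] := CO k.
have mC k : measurable (C k : set (borel X)).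
  by apply: closed_measurable_borel; have [] := CO k.
have mD n : measurable (D n : set (borel X)) by exact: closed_measurable_borel.
have mUC : measurable (\bigcup_k C k : set (borel X)).
  exact: bigcupT_measurable.
have mUO : measurable (\bigcup_k U k : set (borel X)).
  exact: bigcupT_measurable.
have [|n|n m nm x [Ux nCx]| |n Cn] := @nonincreasing_measure_small _ _ _ mu
    (fun n => \bigcup_k C k `\` D n) (e / 2) => //.
- exact: measurableD.
- split=> // -[k /= kn Ckx]; apply: nCx; exists k => //=.
  exact: leq_trans nm.
- rewrite -subset0 => x nD; have [[k _ Ckx] _] := nD 0%N I.
  by have [_] := nD k.+1 I; apply; exists k => /=.
exists (D n), (\bigcup_k U k); split=> //.
- by move=> x [k _ Ckx]; exists k => //; have [_ _ + _ _] := CO k; exact.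
- by move=> x [k _ Akx]; exists k => //; have [_ _ _ + _] := CO k; exact.
apply: (@le_trans _ _ (mu ((\bigcup_k U k `\` \bigcup_k C k) `|`
    (\bigcup_k C k `\` D n)))).
  apply: le_measure; rewrite ?inE.
  - exact: measurableD.
  - by apply: measurableU; exact: measurableD.
  - move=> x [Ux nDx]; have [Cx|nCx] := pselect ((\bigcup_k C k) x).
      by right.
    by left.
apply: le_trans (measureU2 _ _ _) _; [exact: measurableD|exact: measurableD|].
rewrite (splitr e) EFinD; apply: leeD Cn.
apply: (@le_trans _ _ (\sum_(k <oo) mu (U k `\` C k))%E).
  apply: measure_sigma_subadditive => [k||x [[k _ Ukx] nCx]].
  - exact: measurableD.
  - exact: measurableD.
  - by exists k => //; split=> // Ckx; apply: nCx; exists k.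
apply: le_trans (epsilon_trick0 xpredT (ltW e20)).
by apply: lee_nneseries => // k _; have [] := CO k.
Qed.

Lemma measurable_regular (A : set X) :
  measurable (A : set (borel X)) -> regular A.
Proof. exact: (smallest_sub regular_sigma_algebra open_regular). Qed.

Lemma measurable_closed_inner (A : set X) (e : R) : 0 < e ->
  measurable (A : set (borel X)) ->
  exists C : set X, [/\ closed C, C `<=` A &
    (mu (A `\` C : set (borel X)) <= e%:E)%E].
Proof.
move=> e0 mA; have [C [U [cC oO CA AO OC]]] := measurable_regular mA e0.
exists C; split=> //; apply: le_trans OC; apply: le_measure; rewrite ?inE.
- by apply: measurableD => //; exact: closed_measurable_borel.
- by apply: measurableD; [exact: open_measurable_borel|
    exact: closed_measurable_borel].
- by move=> x [/AO].
Qed.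

End regularity.

(** * Entropy and coding *)

Section shannon_entropy.
Context {R : realType} {I : finType}.
Implicit Types (p q c : I -> R).

(* Gibbs' inequality for the code with lengths [c]: the weights [q] dominate
   [expR (- c)] on the support of [p], so Kraft's inequality holds for [c]. *)
Lemma entropy_le_code_length p q c :
  (forall i, 0 <= p i) -> (forall i, 0 <= q i) -> \sum_i q i <= \sum_i p i ->
  (forall i, 0 < p i -> expR (- c i) <= q i) ->
  \sum_i - (p i * ln (p i)) <= \sum_i p i * c i.
Proof.
move=> p0 q0 qp cq.
suff H i : - (p i * ln (p i)) <= p i * c i + (q i - p i).
  apply: (le_trans (ler_sum _ (fun i _ => H i))).
  by rewrite big_split /= sumrB gerDl subr_le0.
have := p0 i; rewrite le_eqVlt => /orP[/eqP pi0|pi_gt0].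
  by rewrite -pi0 !mul0r oppr0 add0r addr0 q0.
have c0 : 0 < expR (- c i) by exact: expR_gt0.
have r0 : 0 < expR (- c i) / p i by rewrite divr_gt0.
have : ln (expR (- c i) / p i) <= expR (- c i) / p i - 1.
  rewrite -[X in ln X](addrNK 1) addrC; apply: le_ln1Dx.
  by rewrite ltrBDr; lra.
rewrite ln_div ?posrE// expRK => /(ler_wpM2l (ltW pi_gt0)).
rewrite mulrBr mulrBr mulr1 mulrCA divff ?gt_eqF// mulr1.
have := cq i pi_gt0; lra.
Qed.

Lemma entropy_sum_subadditive p (Q : pred I) : (forall i, 0 <= p i) ->
  - ((\sum_(i | Q i) p i) * ln (\sum_(i | Q i) p i)) <=
  \sum_(i | Q i) - (p i * ln (p i)).
Proof.
move=> p0; rewrite mulr_suml -sumrN; apply: ler_sum => i Qi.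
rewrite lerN2; have := p0 i; rewrite le_eqVlt => /orP[/eqP <-|pi_gt0].
  by rewrite !mul0r.
have pis : p i <= \sum_(j | Q j) p j.
  by rewrite (bigD1 i)//= lerDl sumr_ge0.
by rewrite ler_pM2l// ler_ln ?posrE// (lt_le_trans pi_gt0).
Qed.

End shannon_entropy.

(* A letter [(k, true)] is known to agree with the code word; [(k, false)] has
   to be recorded, at cost [beta], whatever the code word is. *)
Lemma entropy_le_code {R : realType} {K J : finType} n
    (p : {ffun 'I_n -> K * bool} -> R) (v : J -> 'I_n -> K)
    (alpha beta eta : R) :
  (forall w, 0 <= p w) -> \sum_w p w = 1 -> 0 <= alpha -> 0 <= beta ->
  expR (- alpha) + #|K|%:R * expR (- beta) <= 1 ->
  #|J|%:R <= expR eta ->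
  (forall w : {ffun 'I_n -> K * bool}, 0 < p w ->
    exists i, forall j, (w j).2 -> (w j).1 = v i j) ->
  \sum_w - (p w * ln (p w)) <=
  eta + n%:R * alpha + beta * \sum_(j < n) \sum_(w : {ffun 'I_n -> K * bool} | ~~ (w j).2) p w.
Proof.
move=> p0 p1 alpha0 beta0 Kraft Jeta wv.
pose om (k : K) (l : K * bool) : R :=
  if l.2 then if l.1 == k then expR (- alpha) else 0 else expR (- beta).
have om0 k l : 0 <= om k l.
  by rewrite /om; case: ifP => _; [case: ifP|]; rewrite ?expR_ge0.
have om1 k : \sum_l om k l <= 1.
  rewrite -(pair_bigA _ (fun k' b => om k (k', b))) /=.
  under eq_bigr do rewrite big_bool /om /=.
  by rewrite big_split /= -big_mkcond /= big_pred1_eq sumr_const -mulr_natl.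
pose q w : R := expR (- eta) * \sum_i \prod_j om (v i j) (w j).
pose c (w : {ffun 'I_n -> K * bool}) : R :=
  eta + \sum_j (alpha + (~~ (w j).2)%:R * beta).
have -> : eta + n%:R * alpha + beta * \sum_(j < n) \sum_(w : {ffun 'I_n -> K * bool} | ~~ (w j).2) p w =
    \sum_w p w * c w.
  under [RHS]eq_bigr do rewrite /c mulrDr mulr_sumr.
  rewrite big_split /= -mulr_suml p1 mul1r -addrA; congr (_ + _).
  rewrite exchange_big /=.
  under [RHS]eq_bigr => j _.
    under eq_bigr do rewrite mulrDr.
    rewrite big_split /= -mulr_suml p1 mul1r.
    over.
  rewrite big_split /= sumr_const card_ord mulr_natl; congr (_ + _).
  rewrite mulr_sumr; apply: eq_bigr => j _.
  rewrite mulr_sumr big_mkcond; apply: eq_bigr => w _.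
  by case: ifP => _; rewrite ?mul0r ?mulr0// mul1r mulrC.
apply: (@entropy_le_code_length _ _ p q c) => //.
- move=> w; rewrite mulr_ge0 ?expR_ge0// sumr_ge0// => i _.
  by rewrite prodr_ge0.
- rewrite p1 -mulr_sumr expRN mulrC ler_pdivrMr ?expR_gt0// mul1r.
  apply: le_trans Jeta; rewrite exchange_big /= -sum1_card natr_sum.
  apply: ler_sum => i _; rewrite -(bigA_distr_bigA (fun j => om (v i j))).
  by rewrite prodr_ile1// => j; rewrite om1 sumr_ge0.
move=> w pw; have [i iv] := wv w pw.
rewrite /q /c opprD expRD ler_pM2l ?expR_gt0//.
apply: (@le_trans _ _ (\prod_j om (v i j) (w j))).
  rewrite -sumrN expR_sum; apply: ler_prod => j _; rewrite expR_ge0 /=.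
  rewrite /om; case: ifPn => wj; last by rewrite mul1r ler_expR; lra.
  by rewrite iv// eqxx mul0r addr0.
rewrite (bigD1 i)//= lerDl sumr_ge0// => i' _.
by rewrite prodr_ge0.
Qed.

Section entropy_fibers.
Context {d} {T : measurableType d} {R : realType} (mu : probability T R).
Context {I : finType} (W : T -> I).
Hypothesis mW : forall w, measurable (W @^-1` [set w]).

Lemma measurable_fibers (Q : pred I) : measurable [set x | Q (W x)].
Proof.
have -> : [set x | Q (W x)] = \bigcup_(w in [set` Q]) W @^-1` [set w].
  by apply/seteqP; split=> [x Qx|x [w /= Qw ->]] //; exists (W x).
by apply: fin_bigcup_measurable => //; exact: finite_finset.
Qed.

Lemma measure_fibers (Q : pred I) : fine (mu [set x | Q (W x)]) =
  \sum_(w | Q w) fine (mu (W @^-1` [set w])).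
Proof.
have -> : [set x | Q (W x)] = \bigcup_(w in [set` Q]) W @^-1` [set w].
  by apply/seteqP; split=> [x Qx|x [w /= Qw ->]] //; exists (W x).
rewrite measure_fin_bigcup//; last exact: trivIset_preimage1.
rewrite -(@bigfs _ _ _ _ (index_enum I)) ?index_enum_uniq//; last first.
  by move=> i _; rewrite mem_index_enum.
by rewrite sum_fine// => w _; exact: fin_num_measure.
Qed.

Lemma entropy_le_fibers (D : set (set T)) :
  finite_set D -> trivIset D id -> covers D ->
  (forall B x y, D B -> W x = W y -> B x -> B y) ->
  entropy mu D <= \sum_w - (fine (mu (W @^-1` [set w])) *
                            ln (fine (mu (W @^-1` [set w])))).
Proof.
move=> Dfin Dtriv Dcov Dsat; pose A := fset_set D.
have AD B : (B \in A) = (B \in D) by rewrite /A in_fset_set.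
have Duniq B B' x : D B -> D B' -> B x -> B' x -> B = B'.
  by move=> DB DB' Bx B'x; apply: (Dtriv B B' DB DB'); exists x.
have DA (B : A) : D (val B) by apply/set_mem; rewrite -AD; exact: valP.
have /choice[N Nx] x : exists B : A, val B x.
  have : [set: T] x by [].
  rewrite -Dcov => -[B DB Bx].
  have BA : B \in A by rewrite AD; exact/mem_set.
  by exists (FSetSub BA).
have /choice[r rP] w : exists x, forall y, W y = w -> W x = w.
  have [[x xw]|nw] := pselect (exists x, W x = w); first by exists x.
  by exists point => y yw; exfalso; apply: nw; exists y.
pose g w := N (r w).
have BE (B : A) : val B = [set x | g (W x) == B].
  have gN x : g (W x) = N x.
    apply/val_inj/(Duniq _ _ (r (W x)) (DA _) (DA _) (Nx _)).
    by apply: Dsat (Nx x) => //; rewrite (rP _ x).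
  apply/seteqP; split=> [x Bx|x /= /eqP <-]; last by rewrite gN; exact: Nx.
  by apply/eqP/val_inj; rewrite gN; exact: Duniq (DA _) (DA _) (Nx x) Bx.
rewrite /entropy fsbig_finite// -sumrN big_seq_fsetE /=.
rewrite (partition_big g xpredT)//=; apply: ler_sum => B _.
rewrite -/(val B) BE (measure_fibers (fun w => g w == B)).
apply: entropy_sum_subadditive => w.
by rewrite fine_ge0.
Qed.

End entropy_fibers.

(** * Measure entropy along a cyclic subgroup *)

Lemma continuous_measurable_borel {X Y : ptopologicalType} (f : X -> Y)
    (A : set Y) : continuous f -> measurable (A : set (borel Y)) ->
  measurable (f @^-1` A : set (borel X)).
Proof.
move=> cf mA; rewrite -[f @^-1` A]setTI.
suff mf : measurable_fun [set: borel X] (f : borel X -> borel Y) by apply: mf.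
apply: (@measurability _ _ (borel X) (borel Y) setT f (@open Y)) => // _ [B oB <-]; rewrite setTI.
by apply: sub_gen_smallest; move/continuousP : cf; exact.
Qed.

Lemma exists_code_lengths {R : realType} (k : nat) (alpha : R) : 0 < alpha ->
  exists2 beta, 0 <= beta & expR (- alpha) + k%:R * expR (- beta) <= 1.
Proof.
move=> alpha0; pose delta := 1 - expR (- alpha).
have delta0 : 0 < delta by rewrite subr_gt0 -expR0 ltr_expR oppr_lt0.
have beta0 : 0 <= k%:R / delta by rewrite divr_ge0// ltW.
exists (k%:R / delta) => //; rewrite -lerBrDl -/delta expRN.
rewrite ler_pdivrMr ?expR_gt0// mulrC -ler_pdivrMr//.
by apply: le_trans (expR_ge1Dx _); rewrite lerDr.
Qed.

Section naive_measure_entropy.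
Context (R : realType) {G : groupType} {X : pmetricType R}.
Variables (a : G -> X -> X) (h : G).
Hypothesis a_morph : {morph a : g k / (g * k)%g >-> g \o k}.
Hypothesis a1 : a 1%g = id.
Hypothesis h_order : has_infinite_order h.
Hypothesis a_continuous : forall g, continuous (a g).
Variable mu : probability (borel X) R.
Let b : G -> borel X -> borel X := a.
Let S := b h^-1%g.
Hypothesis mu_invariant : invariant_measure b mu.

Let measurable_iter j (A : set (borel X)) :
  measurable A -> measurable (iter j S @^-1` A).
Proof.
apply: (@continuous_measurable_borel X X (iter j (a h^-1%g))).
exact: continuous_iter.
Qed.

Let measure_iter j (A : set (borel X)) :
  measurable A -> mu (iter j S @^-1` A) = mu A.
Proof.
move=> mA; elim: j => [//|j IHj]; rewrite -IHj.
have -> : iter j.+1 S @^-1` A = S @^-1` (iter j S @^-1` A).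
  by apply/funext => x /=; rewrite -iterSr.
by rewrite [LHS]mu_invariant//; exact: measurable_iter.
Qed.

Lemma naive_entropy_ge0 : (0 <= naive_entropy b mu)%E.
Proof.
have : finite_measurable_partition [set [set: borel X]].
  split.
  - exact: finite_set1.
  - by move=> _ ->; exact: measurableT.
  - by move=> _ _ -> ->.
  - by rewrite /covers bigcup_set1.
move=> XP; apply: le_trans (ereal_sup_ubound _); last first.
  by exists [set [set: borel X]].
apply: le_ereal_inf_tmp => _ [F _ <-]; rewrite lee_fin divr_ge0//.
rewrite /entropy fsbig1 ?oppr0// => B [u uP <-].
have -> : \bigcap_(i in [set` F]) u i = [set: borel X].
  apply/seteqP; split=> // x _ g /uP[_ -> <-]; rewrite action_inv_image//.
by rewrite probability_setT /= ln1 mulr0.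
Qed.

Lemma naive_entropy_partition_le0 (P : set (set (borel X))) :
  (forall (K : Type) (E : K -> set X), (forall k, open (E k)) ->
    (forall x, exists k, E k x) -> zero_entropy R (a h^-1%g) E) ->
  finite_measurable_partition P -> (naive_entropy_partition b mu P <= 0)%E.
Proof.
move=> cover0 [/finite_fsetP[K PK] mP trivP covP].
have PE B : P B = (B \in K) :> Prop by rewrite PK.
have Puniq B B' x : P B -> P B' -> B x -> B' x -> B = B'.
  by move=> PB PB' Bx B'x; apply: (trivP B B' PB PB'); exists x.
have PvalK (k : K) : P (val k) by rewrite PE; exact: valP.
have /choice[nm nmx] x : exists k : K, val k x.
  have : [set: borel X] x by [].
  rewrite -covP => -[B PB Bx]; have BK : B \in K by rewrite -PE.
  by exists (FSetSub BK).
have nmE (k : K) x : val k x -> nm x = k.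
  by move=> kx; apply/val_inj; exact: Puniq (PvalK _) (PvalK _) (nmx x) kx.
apply/lee_addgt0Pr => e e0; rewrite add0e.
have alpha0 : 0 < e / 4 by rewrite divr_gt0.
have [beta beta0 Kraft] := exists_code_lengths #|{: K}| alpha0.
pose gamma := e / 4 / ((#|{: K}|%:R + 1) * (beta + 1)).
have gamma0 : 0 < gamma.
  by rewrite divr_gt0// mulr_gt0// ltr_wpDl.
have gammaE : beta * (#|{: K}|%:R * gamma) <= e / 4.
  rewrite /gamma (mulrCA #|{: K}|%:R) (mulrCA beta) ger_pMr// mulrA.
  rewrite ler_pdivrMr ?mulr_gt0 ?ltr_wpDl// mul1r.
  have : 0 <= #|{: K}|%:R :> R by [].
  by move: beta0; nra.
have /choice[C CP] (k : K) := measurable_closed_inner mu gamma0 (mP _ (PvalK k)).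
pose c x : K * bool := (nm x, `[< C (nm x) x >]).
have mC k : measurable (C k : set (borel X)).
  have [cC _ _] := CP k; rewrite -[C k]setCK; apply: measurableC.
  by apply: sub_gen_smallest; rewrite /= openC.
have mc l : measurable (c @^-1` [set l] : set (borel X)).
  case: l => k bl.
  have -> : c @^-1` [set (k, bl)] =
      val k `&` (if bl then C k else ~` C k).
    apply/seteqP; split=> [x [<- <-]|x [kx]].
      by split; [exact: nmx|case: ifPn => /asboolP].
    rewrite /c /= (nmE _ _ kx); case: bl => Cx; congr pair.
      exact/asboolP.
    exact/asboolPn.
  apply: measurableI; first exact: mP.
  by case: bl => //; exact: measurableC.
have mbad : measurable ([set x | ~~ (c x).2] : set (borel X)).
  exact: (measurable_fibers (W := c) mc (fun l => ~~ l.2)).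
have bad_le : (mu [set x | ~~ (c x).2] <= (#|{: K}|%:R * gamma)%:E)%E.
  have -> : (#|{: K}|%:R * gamma)%:E = (\sum_(k : K) gamma%:E)%E.
    by rewrite sumEFin sumr_const mulr_natl.
  apply: le_trans (@content_sub_fsum _ _ _ mu _ [set` xpredT : pred K] _
    (fun k : K => val k `\` C k) _ _ mbad _) _.
  - exact: finite_finset.
  - by move=> k _; apply: measurableD => //; exact: mP.
  - move=> x /= /asboolPn nCx; exists (nm x) => //; split=> //; exact: nmx.
  rewrite -(@bigfs _ _ _ _ (index_enum K)) ?index_enum_uniq//; last first.
    by move=> i _; rewrite mem_index_enum.
  by rewrite lee_sum// => k _; have [] := CP k.
pose E (k : K) : set X := ~` \bigcup_(k' in [set k' | k' <> k]) C k'.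
have E0 : zero_entropy R (a h^-1%g) E.
  apply: cover0 => [k|x].
    rewrite /E openC; apply: closed_bigcup; first exact: finite_finset.
    by move=> k' _; have [] := CP k'.
  exists (nm x) => -[k' /= k'x Ck'x]; apply: k'x.
  by apply/esym/nmE; have [_ + _] := CP k'; exact.
have [n [n0 [J [v [vn vx]]]]] : exists n : nat, (0 < n)%N /\
    exists (J : finType) (v : J -> nat -> K), #|J|%:R <= expR (e / 4 * n%:R) /\
    forall x, exists i, forall j, (j < n)%N ->
      E (v i j) (iter j (a h^-1%g) x).
  near \oo => n; exists n; split; first by near: n; exact: nbhs_infty_gt.
  by near: n; exact: E0.
apply: le_trans (ereal_inf_lbound _) _.
  exists (fset_powers h n) => //=.
  by rewrite -cardfs_gt0 card_fset_powers.
rewrite lee_fin card_fset_powers// ler_pdivrMr ?ltr0n//.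
pose W (x : borel X) : {ffun 'I_n -> K * bool} := [ffun j : 'I_n => c (iter j S x)].
have mW w : measurable (W @^-1` [set w]).
  have -> : W @^-1` [set w] =
      \bigcap_(j in [set: 'I_n]) (iter j S @^-1` (c @^-1` [set w j])).
    apply/seteqP; split=> [x <- j _|x xw]; first by rewrite /= ffunE.
    by apply/ffunP => j; rewrite ffunE; exact: xw.
  apply: fin_bigcap_measurable; first exact: finite_finset.
  by move=> j _; exact: measurable_iter.
pose D := join_translates b (fset_powers h n) P.
have DP B : D B <-> exists2 u : nat -> set X, (forall j, (j < n)%N -> P (u j)) &
    B = [set x | forall j, (j < n)%N -> u j (iter j S x)].
  exact: join_translates_powersP.
have nm_iter (u : nat -> set X) x : (forall j, (j < n)%N -> P (u j)) ->
    (forall j, (j < n)%N -> u j (iter j S x)) ->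
    forall j, (j < n)%N -> u j = val (nm (iter j S x)).
  by move=> Pu ux j jn; exact: Puniq (Pu _ jn) (PvalK _) (ux _ jn) (nmx _).
have Dfin : finite_set D.
  pose B (f : {ffun 'I_n -> K}) :=
    [set x | forall j : 'I_n, val (f j) (iter j S x)].
  apply: (@sub_finite_set _ _ (B @` [set: _])); last first.
    exact/finite_image/finite_finset.
  move=> _ /DP[u Pu ->].
  have uK (j : 'I_n) : u j \in K by rewrite -PE; exact: Pu.
  exists [ffun j => FSetSub (uK j)] => //; apply/seteqP; split=> x xu.
    by move=> j jn; have := xu (Ordinal jn); rewrite ffunE.
  by move=> j; rewrite ffunE; exact: xu.
have Dtriv : trivIset D id.
  move=> _ _ /DP[u Pu ->] /DP[u' Pu' ->] [x [xu xu']].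
  have uu' j : (j < n)%N -> u j = u' j.
    by move=> jn; rewrite (nm_iter u x)// (nm_iter u' x).
  apply/seteqP; split=> y yu j jn; have := yu j jn; rewrite uu'//.
have Dcov : covers D.
  apply/seteqP; split=> // x _.
  exists [set y | forall j, (j < n)%N -> val (nm (iter j S x)) (iter j S y)].
    by apply/DP; exists (fun j => val (nm (iter j S x))).
  by move=> j _; exact: nmx.
have Dsat B x y : D B -> W x = W y -> B x -> B y.
  move=> /DP[u Pu ->] Wxy xu j jn; rewrite (nm_iter u x)//.
  have /ffunP/(_ (Ordinal jn)) := Wxy; rewrite !ffunE => -[-> _].
  exact: nmx.
apply: le_trans (entropy_le_fibers mu mW Dfin Dtriv Dcov Dsat) _.
have badW j : \sum_(w : {ffun 'I_n -> K * bool} | ~~ (w j).2)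
    fine (mu (W @^-1` [set w])) <= #|{: K}|%:R * gamma.
  have <- := measure_fibers mu mW (fun w => ~~ (w j).2).
  rewrite -lee_fin fineK; last first.
    apply: fin_num_measure.
    exact: (measurable_fibers (W := W) mW (fun w => ~~ (w j).2)).
  apply: le_trans bad_le; rewrite le_eqVlt; apply/orP; left; apply/eqP.
  rewrite -(measure_iter j mbad).
  by congr (mu _); apply/funext => x /=; rewrite ffunE.
apply: le_trans (entropy_le_code (v := fun i (j : 'I_n) => v i j)
    (alpha := e / 4) (beta := beta) (eta := e / 4 * n%:R) _ _ _ _ _ _ _) _ => //.
- by move=> w; exact: fine_ge0.
- have <- := measure_fibers mu mW xpredT.
  by rewrite (_ : [set _ | _] = [set: borel X]) ?probability_setT//; exact/seteqP.
- exact: ltW.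
- move=> w pw; have [x xw] : W @^-1` [set w] !=set0.
    by apply/set0P/eqP => w0; move: pw; rewrite w0 measure0 ltxx.
  have [i ix] := vx x; exists i => j.
  rewrite -xw ffunE /= => /asboolP Cx.
  apply: contrapT => nv; apply: (ix j (ltn_ord j)).
  by exists (nm (iter j S x)).
have : \sum_(j < n) \sum_(w : {ffun 'I_n -> K * bool} | ~~ (w j).2)
    fine (mu (W @^-1` [set w])) <= n%:R * (#|{: K}|%:R * gamma).
  rewrite mulr_natl -[X in _ *+ X]card_ord -sumr_const.
  by apply: ler_sum => j _; exact: badW.
move=> /(ler_wpM2l beta0) /le_trans sum_le.
have : beta * (n%:R * (#|{: K}|%:R * gamma)) <= n%:R * (e / 4).
  by rewrite mulrCA ler_wpM2l.
move=> /sum_le; have : 0 <= n%:R :> R by [].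
by move: (\sum_(j < n) _) => s; nra.
Unshelve. all: by end_near. Qed.

End naive_measure_entropy.

Theorem mainTheorem5 (R : realType) (G : groupType) (X : pmetricType R)
    (a : G -> X -> X)
    (G_countable : countable [set: G])
    (G_infinite_order : exists g : G, has_infinite_order g)
    (X_compact : compact [set: X])
    (a_action : is_action_by_homeo a)
    (a_distal : distal a) :
  naive_top_entropy R a = 0%E /\
  (forall mu : probability (borel X) R,
    invariant_measure (a : G -> borel X -> borel X) mu ->
    naive_entropy (a : G -> borel X -> borel X) mu = 0%E).
Proof.
have [h h_order] := G_infinite_order.
have [a_homeo a_morph] := a_action.
have a_cont g : continuous (a g) by have [] := a_homeo g.
have a1 : a 1%g = id.
  have [_ [f [_ fK _]]] := a_homeo 1%g.
  apply/funext => x; apply: (can_inj fK).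
  by rewrite -[LHS]/((a 1%g \o a 1%g) x) -a_morph mulg1.
have T_distal x y : x <> y -> exists2 e, 0 < e &
    forall m, e <= mdist (iter m (a h^-1%g) x) (iter m (a h^-1%g) y).
  move=> xy; exists (inf [set mdist (a g x) (a g y) | g in [set: G]]).
    exact: a_distal.
  move=> m; apply: ge_inf.
    by exists 0 => _ [g _ <-]; exact: mdist_ge0.
  by exists (h^-1 ^+ m)%g => //; rewrite !action_expg.
have cover0 (K : Type) (E : K -> set X) : (forall k, open (E k)) ->
    (forall x, exists k, E k x) -> zero_entropy R (a h^-1%g) E.
  exact: distal_zero_entropy_cover.
split=> [|mu mu_inv]; apply/eqP; rewrite eq_le; apply/andP; split.
- apply: ge_ereal_sup => _ [U [_ oU covU] <-].
  apply: (naive_top_entropy_cover_le0 a_morph a1 h_order); apply: cover0 => [A|x].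
    have [UA|nUA] := pselect (U A).
      by rewrite (_ : [set x | _] = A); [exact: oU|apply/seteqP; split=> x // []].
    by rewrite (_ : [set x | _] = set0); [exact: open0|apply/seteqP; split=> x // []].
  have : [set: X] x by [].
  by rewrite -covU => -[A UA Ax]; exists A.
- exact: naive_top_entropy_ge0.
- apply: ge_ereal_sup => _ [P PP <-].
  exact: (naive_entropy_partition_le0 a_morph a1 h_order).
- exact: naive_entropy_ge0.
Qed.
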